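(* Let $\mathcal{G}$ be a principal \'etale groupoid with the Fourier coefficients approximation property. Then each diagonal bimodule $M$ of $C_r^*(\mathcal{G})$ is spectral.
   Context: An \'etale groupoid means a second countable, locally compact, Hausdorff topological groupoid $\mathcal{G}$ whose range and source maps $r,s:\mathcal{G}\to\mathcal{G}^{(0)}$ are local homeomorphisms; $\mathcal{G}^{(0)}$ is the unit space and $\mathcal{G}_u=s^{-1}(u)$. $\mathcal{G}$ is principal if every $\gamma$ with $r(\gamma)=s(\gamma)$ is a unit. $C_c(\mathcal{G})$ is a $*$-algebra with $f^*(\gamma)=\overline{f(\gamma^{-1})}$ and $(fg)(\gamma)=\sum_{\gamma'\in\mathcal{G}_{s(\gamma)}}f(\gamma\gamma'^{-1})g(\gamma')$; $C_r^*(\mathcal{G})$ is its completion in the norm $\|f\|_{\mathrm{red}}=\sup_{u\in\mathcal{G}^{(0)}}\|\mathrm{Ind}_u(f)\|$, where $\mathrm{Ind}_u(f)\xi(\gamma)=\sum_{\gamma'\in\mathcal{G}_u}f(\gamma\gamma'^{-1})\xi(\gamma')$ on $\ell^2(\mathcal{G}_u)$. The inclusion $C_c(\mathcal{G})\subseteq C_0(\mathcal{G})$ extends to a norm-decreasing injective linear map $j:C_r^*(\mathcal{G})\to C_0(\mathcal{G})$, and each $a\in C_r^*(\mathcal{G})$ is identified with the function $j(a)$; write $a(\gamma)=j(a)(\gamma)$ and $\mathrm{supp}'(a)=\{\gamma\in\mathcal{G}:a(\gamma)\neq0\}$. $C_0(\mathcal{G}^{(0)})$ is regarded as a $C^*$-subalgebra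 of $C_r^*(\mathcal{G})$. For open $P\subseteq\mathcal{G}$, $C_c(P)\subseteq C_c(\mathcal{G})$ via extension by zero. A diagonal bimodule of $C_r^*(\mathcal{G})$ is a norm closed subspace $M$ such that $ab,ba\in M$ for all $a\in M$, $b\in C_0(\mathcal{G}^{(0)})$. Its spectrum is $\sigma(M)=\{\gamma\in\mathcal{G}:a(\gamma)\ne0\text{ for some }a\in M\}$. For open $P\subseteq\mathcal{G}$, $A(P)=\{a\in C_r^*(\mathcal{G}):a(\gamma)=0\text{ for all }\gamma\notin P\}$ (so $A(\emptyset)=\{0\}$). $M$ is spectral if $M=A(\sigma(M))$. $\mathcal{G}$ has the Fourier coefficients approximation property if $a\in\overline{C_c(\mathrm{supp}'(a))}$ (closure in the reduced norm) for all $a\in C_r^*(\mathcal{G})$. *)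

(* Defs.v *)
From HB Require Import structures.
From mathcomp Require Import all_boot all_order all_algebra.
From mathcomp Require Import all_classical all_reals all_analysis.
From mathcomp Require Import complex.

Set Implicit Arguments.
Unset Strict Implicit.
Unset Printing Implicit Defensive.

Import Order.TTheory GRing.Theory Num.Theory.
Import numFieldNormedType.Exports.

Local Open Scope classical_set_scope.
Local Open Scope ring_scope.

(* [R[i]] itself does not canonically unify with the topological instances of
   a [numFieldType]; seen through this constant it carries its norm topology. *)
Definition Cplx (R : realType) : numClosedFieldType := R[i].

Definition modulus (R : realType) (z : Cplx R) : R := complex.Re `|z|.

(* [f] is a local homeomorphism from [T] to the subspace [B] of [T']. *)
Definition local_homeomorphism (T T' : topologicalType) (B : set T')
    (f : T -> T') : Prop :=
  (forall x, B (f x)) /\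
  forall x, exists U : set T,
    [/\ open U, U x, {within U, continuous f}, set_inj U f &
        forall V, open V -> V `<=` U ->
          exists2 W, open W & f @` V = W `&` B].

(* A groupoid is presented by its set of arrows, the units being identified
   with arrows; [gmul x y] is only meaningful when [gsrc x = grng y]. *)
Record etale_groupoid : Type := EtaleGroupoid {
  garr :> topologicalType;
  gsrc : garr -> garr;
  grng : garr -> garr;
  ginv : garr -> garr;
  gmul : garr -> garr -> garr;
  gsrc_src : forall x, gsrc (gsrc x) = gsrc x;
  grng_src : forall x, grng (gsrc x) = gsrc x;
  gsrc_rng : forall x, gsrc (grng x) = grng x;
  grng_rng : forall x, grng (grng x) = grng x;
  gsrc_mul : forall x y, gsrc x = grng y -> gsrc (gmul x y) = gsrc y;
  grng_mul : forall x y, gsrc x = grng y -> grng (gmul x y) = grng x;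
  gmulA : forall x y z, gsrc x = grng y -> gsrc y = grng z ->
    gmul x (gmul y z) = gmul (gmul x y) z;
  gmul_src : forall x, gmul x (gsrc x) = x;
  gmul_rng : forall x, gmul (grng x) x = x;
  gsrc_inv : forall x, gsrc (ginv x) = grng x;
  grng_inv : forall x, grng (ginv x) = gsrc x;
  gmul_inv : forall x, gmul x (ginv x) = grng x;
  ginv_mul : forall x, gmul (ginv x) x = gsrc x;
  ginv_continuous : continuous ginv;
  gmul_continuous :
    {within [set p : garr * garr | gsrc p.1 = grng p.2],
      continuous (fun p : garr * garr => gmul p.1 p.2)};
  g_second_countable : @second_countable garr;
  g_locally_compact : locally_compact [set: garr];
  g_hausdorff : hausdorff_space garr;
  gsrc_local_homeo : local_homeomorphism [set u | gsrc u = u] gsrc;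
  grng_local_homeo : local_homeomorphism [set u | gsrc u = u] grng
}.

Definition units (G : etale_groupoid) : set G := [set u | gsrc u = u].

Definition src_fiber (G : etale_groupoid) (u : G) : set G :=
  [set x | gsrc x = u].

Definition principal (G : etale_groupoid) : Prop :=
  forall x : G, grng x = gsrc x -> units x.

(* For open [P], the functions on [G] obtained from [C_c(P)] through extension
   by zero: continuous, with compact support contained in [P]. *)
Definition Cc (R : realType) (G : etale_groupoid) (P : set G) :
    set (G -> Cplx R) :=
  [set f | [/\ continuous f, compact (closure [set x | f x != 0]) &
               closure [set x | f x != 0] `<=` P]].

Definition C0 (R : realType) (G : etale_groupoid) : set (G -> Cplx R) :=
  [set f | continuous f /\
           forall e : R, 0 < e -> compact [set x | e <= modulus (f x)]].

(* The sums below are over sets where, for [f] in [C_c(G)], only finitely many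
   terms are nonzero; this is what [\sum_(_ \in _)] computes. *)
Definition convolution (R : realType) (G : etale_groupoid)
    (f g : G -> Cplx R) : G -> Cplx R :=
  fun x => \sum_(y \in src_fiber (gsrc x)) (f (gmul x (ginv y)) * g y).

Definition involution (R : realType) (G : etale_groupoid)
    (f : G -> Cplx R) : G -> Cplx R :=
  fun x => (f (ginv x))^*.

(* Vectors of [l^2(G_u)] are represented by functions on [G], of which only the
   values on [G_u] are used. *)
Definition l2norm (R : realType) (G : etale_groupoid) (u : G)
    (xi : G -> Cplx R) : \bar R :=
  poweR (\esum_(x in src_fiber u) (modulus (xi x) ^+ 2)%:E) 2^-1.

Definition Ind (R : realType) (G : etale_groupoid) (u : G)
    (f : G -> Cplx R) (xi : G -> Cplx R) : G -> Cplx R :=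
  fun x => \sum_(y \in src_fiber u) (f (gmul x (ginv y)) * xi y).

Definition Ind_norm (R : realType) (G : etale_groupoid) (u : G)
    (f : G -> Cplx R) : \bar R :=
  ereal_sup [set l2norm u (Ind u f xi) | xi in
             [set xi : G -> Cplx R | (l2norm u xi <= 1)%E]].

(* [0] is added so that the supremum is [0], not [-oo], for the empty
   groupoid. *)
Definition red_norm (R : realType) (G : etale_groupoid)
    (f : G -> Cplx R) : \bar R :=
  ereal_sup (0%E |` [set Ind_norm u f | u in @units G]).

(* Possibly non-unital C*-algebras; the ring structures of the library have
   a unit. *)
Record cstar_algebra (R : realType) : Type := CstarAlgebra {
  cs_car :> completeNormedModType (Cplx R);
  cs_mul : cs_car -> cs_car -> cs_car;
  cs_star : cs_car -> cs_car;
  cs_mulA : forall a b c, cs_mul a (cs_mul b c) = cs_mul (cs_mul a b) c;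
  cs_mulDl : forall a b c, cs_mul (a + b) c = cs_mul a c + cs_mul b c;
  cs_mulDr : forall a b c, cs_mul a (b + c) = cs_mul a b + cs_mul a c;
  cs_mulZl : forall (z : Cplx R) a b, cs_mul (z *: a) b = z *: cs_mul a b;
  cs_mulZr : forall (z : Cplx R) a b, cs_mul a (z *: b) = z *: cs_mul a b;
  cs_starK : forall a, cs_star (cs_star a) = a;
  cs_starD : forall a b, cs_star (a + b) = cs_star a + cs_star b;
  cs_starZ : forall (z : Cplx R) a, cs_star (z *: a) = z^* *: cs_star a;
  cs_starM : forall a b, cs_star (cs_mul a b) = cs_mul (cs_star b) (cs_star a);
  cs_norm_mul : forall a b, `|cs_mul a b| <= `|a| * `|b|;
  cs_norm_star_mul : forall a, `|cs_mul (cs_star a) a| = `|a| ^+ 2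
}.

(* [C_r^*(G)] as a completion of the *-algebra [C_c(G)] for [red_norm]: a
   C*-algebra with an isometric *-homomorphism [rc_in] of dense range. The
   values of [rc_in] outside [C_c(G)] are irrelevant. *)
Record reduced_cstar (R : realType) (G : etale_groupoid) : Type :=
  ReducedCstar {
  rc_alg :> cstar_algebra R;
  rc_in : (G -> Cplx R) -> rc_alg;
  rc_in_linear : forall (z : Cplx R) f g, Cc [set: G] f -> Cc [set: G] g ->
    rc_in (fun x => z * f x + g x) = z *: rc_in f + rc_in g;
  rc_in_mul : forall f g, Cc [set: G] f -> Cc [set: G] g ->
    rc_in (convolution f g) = cs_mul (rc_in f) (rc_in g);
  rc_in_star : forall f, Cc [set: G] f ->
    rc_in (involution f) = cs_star (rc_in f);
  rc_in_norm : forall f, Cc [set: G] f ->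
    (complex.Re `|rc_in f|)%:E = red_norm f;
  rc_in_dense : closure (rc_in @` Cc [set: G]) = setT
}.

(* [j] is the norm-decreasing injective linear map from [C_r^*(G)] to [C_0(G)]
   extending the inclusion of [C_c(G)]; by density there is only one. *)
Definition is_coefficient_map (R : realType) (G : etale_groupoid)
    (A : reduced_cstar R G) (j : A -> G -> Cplx R) : Prop :=
  [/\ forall a, C0 (j a),
      forall (z : Cplx R) a b x, j (z *: a + b) x = z * j a x + j b x,
      forall a x, `|j a x| <= `|a|,
      injective j &
      forall f, Cc [set: G] f -> j (rc_in A f) = f].

(* [C_0(G^(0))] inside [C_r^*(G)]. *)
Definition diagonal (R : realType) (G : etale_groupoid)
    (A : reduced_cstar R G) : set A :=
  closure (rc_in A @` Cc (@units G)).

Definition diagonal_bimodule (R : realType) (G : etale_groupoid)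
    (A : reduced_cstar R G) (M : set A) : Prop :=
  [/\ closed M,
      M 0,
      forall (z : Cplx R) a b, M a -> M b -> M (z *: a + b) &
      forall a b, M a -> diagonal b -> M (cs_mul a b) /\ M (cs_mul b a)].

Definition supp' (R : realType) (G : etale_groupoid) (A : reduced_cstar R G)
    (j : A -> G -> Cplx R) (a : A) : set G :=
  [set x | j a x != 0].

Definition spectrum (R : realType) (G : etale_groupoid)
    (A : reduced_cstar R G) (j : A -> G -> Cplx R) (M : set A) : set G :=
  [set x | exists2 a, M a & j a x != 0].

Definition spectral_subspace (R : realType) (G : etale_groupoid)
    (A : reduced_cstar R G) (j : A -> G -> Cplx R) (P : set G) : set A :=
  [set a | forall x, ~ P x -> j a x = 0].

Definition spectral (R : realType) (G : etale_groupoid)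
    (A : reduced_cstar R G) (j : A -> G -> Cplx R) (M : set A) : Prop :=
  M = spectral_subspace j (spectrum j M).

Definition fourier_approximation (R : realType) (G : etale_groupoid)
    (A : reduced_cstar R G) (j : A -> G -> Cplx R) : Prop :=
  forall a : A, closure (rc_in A @` Cc (supp' j a)) a.

(* Main.v *)
Require Import Defs.
From HB Require Import structures.
From mathcomp Require Import all_boot all_order all_algebra finmap.
From mathcomp Require Import all_classical all_reals all_analysis.
From mathcomp Require Import complex.
From mathcomp Require Import ring lra.

(** That [M] lies in [A(sigma(M))] is immediate. Conversely, if [a] vanishes off
    [sigma(M)], then the approximation property makes [a] a limit of functions
    of [C_c(sigma(M))]; as [M] is closed, it is enough that
    [C_c(sigma(M))] is contained in [M]
    ([bimodule_contains_Cc_spectrum]). By a partition of unity this is a local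
    matter: near a point where some [a] in [M] does not vanish.

    So let [a] be in [M], let [U] be an open bisection, and let [f] have compact
    support in the part of [U] where [a] is nonzero. Then [f = phi a] pointwise
    for some [phi] in [C_c(U)], and the point is to perform the multiplication
    by [phi], which is a Schur multiplier and not a diagonal operation, inside
    the bimodule. The candidates are the maps
    [Phi(a) = sum_i h_i a k_i] with [h_i], [k_i] in [C_c(G^(0))]: they preserve
    [M], and on functions they multiply the value at [x] by
    [sum_i h_i(r x) k_i(s x)]. Take a partition [sum_i q_i^2 = 1] on the support
    of [phi], let [h_i] be [phi q_i] transported to [G^(0)] along [r : U -> r(U)]
    and let [k_i] be [q_i] transported along [s : U -> s(U)]. On [U] the
    multiplier is then [phi]. Outside [U] it need not vanish, but over a given
    compact set [C] it does once the supports of the [q_i] are small enough: this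
    is where principality enters, since an arrow of [C] that is not in [U] differs
    from each [x] of [U] in its range or in its source
    ([separated_neighbourhood], [exists_multipliers]).

    The second point is that [Phi] has norm at most [sup |phi|], however fine the
    partition and hence uniformly in [C]. This is the norm inequality for a row
    times a diagonal matrix times a column, with
    [sum_i |h_i|^2 <= (sup |phi|)^2] and [sum_i |k_i|^2 <= 1]; it is obtained
    from the Cauchy-Schwarz inequality in each regular representation
    ([red_norm_row_column]).

    To conclude ([bimodule_contains_local]), approximate [a] by [g] in
    [C_c(G)] and take [C] to be the support of [g]. Then [Phi(g) = phi g],
    while [Phi(a)] is in [M] and is close to [Phi(g)]. It remains to compare
    [phi g] with [f = phi a], which are uniformly close; since their difference
    is supported in the bisection [U], the same multiplier bound, applied to the
    product of a small function of [C_c(U)] by a fixed bump, converts uniform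
    closeness into closeness in norm. *)

Set Implicit Arguments.
Unset Strict Implicit.
Unset Printing Implicit Defensive.
Import Order.TTheory GRing.Theory Num.Theory.
Import numFieldNormedType.Exports.
Local Open Scope classical_set_scope.
Local Open Scope ring_scope.

(** * Partitions of unity on locally compact spaces *)

(** A finite subcover argument packaged as an induction: were [P K] false, the
    sets [A] such that [P] holds of [K] minus [A] would form a proper filter
    containing [K], and a neighbourhood with [P] of a cluster point would
    contradict that. *)
Lemma compact_induction (T : topologicalType) (P : set T -> Prop) (K : set T) :
  compact K -> P set0 ->
  (forall A B, P B -> A `<=` B -> P A) ->
  (forall A B, P A -> P B -> P (A `|` B)) ->
  (forall x, K x -> exists2 N, nbhs x N & P N) -> P K.
Proof.
move=> cK P0 PS PU Ploc; apply: contrapT => nPK.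
pose F : set_system T := fun A => P (K `\` A).
have FF : ProperFilter F.
  apply: Build_ProperFilter_ex => [A FA|].
    apply: contrapT => A0; apply: nPK; apply: PS FA _ => x Kx; split => // Ax.
    by apply: A0; exists x.
  split; first by rewrite /F setDT.
    by move=> A B FA FB; rewrite /F setDIr; exact: PU.
  by move=> A B AB FA; apply: PS FA _; exact: setDS.
have FK : F K by rewrite /F setDv.
have [x [Kx clx]] := cK F FF FK; have [N Nx PN] := Ploc x Kx.
have FN : F (~` N) by apply: PS PN _ => y [_ /contrapT].
by have [y []] := clx _ _ FN Nx.
Qed.

Lemma continuous_maxr (R : realType) (T : topologicalType) (x : T) (f g : T -> R) :
  {for x, continuous f} -> {for x, continuous g} ->
  {for x, continuous (fun y => Num.max (f y) (g y))}.
Proof.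
move=> cf cg.
have -> : (fun y => Num.max (f y) (g y)) =
    (fun y => (f y + g y + `|f y - g y|) / 2).
  by apply/funext => y; rewrite Num.Theory.maxr_absE.
apply: cvgM; last exact: cvg_cst.
by apply: cvgD; [exact: cvgD|apply: cvg_norm; exact: cvgB].
Qed.

Lemma continuous_sum (K : numFieldType) (T : topologicalType) (I : eqType)
    (r : seq I) (f : I -> T -> K) (x : T) :
  (forall i, i \in r -> {for x, continuous (f i)}) ->
  {for x, continuous (fun y => \sum_(i <- r) f i y)}.
Proof.
elim: r => [_|i r IH cf].
  have -> : (fun y => \sum_(i <- [::]) f i y) = (fun=> 0 : K).
    by apply/funext => y; rewrite big_nil.
  exact: cvg_cst.
have -> : (fun y => \sum_(k <- i :: r) f k y) =
    (fun y => f i y + \sum_(k <- r) f k y).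
  by apply/funext => y; rewrite big_cons.
apply: cvgD; first by apply: cf; rewrite mem_head.
by apply: IH => k kr; apply: cf; rewrite inE kr orbT.
Qed.

Section Bumps.
Variables (R : realType) (T : topologicalType).
Hypothesis lcT : locally_compact [set: T].
Hypothesis hT : hausdorff_space T.

Lemma exists_bump (x : T) (U : set T) : open U -> U x ->
  exists b : T -> R, [/\ continuous b, b x = 1,
    compact (closure [set y | b y != 0]) & closure [set y | b y != 0] `<=` U].
Proof.
move=> oU Ux.
have [W nW [cW clW]] : exists2 W, nbhs x W & compact W /\ closed W.
  have [W nW [cW clW]] := lcT (I : [set: T] x).
  exists W => //; rewrite -[W]setTI.
  have : nbhs x [set y | [set: T] y -> W y] := nW.
  by apply: filterS => y h; split; last exact: h.
pose O := W° `&` U.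
have oO : open O by apply: openI => //; exact: open_interior.
have cO : closed (~` O) by exact: open_closedC.
have nO : ~ (~` O) x by move=> /(_ (conj _ Ux)); apply.
have /(@uniform_separatorP T R) :=
  locally_compact_completely_regular (R := R) lcT hT cO nO.
move=> [f [cf f01 f0 f1]].
(* Cutting [f] off at level 1/2 keeps the closed support away from the set
   where [f = 1]. *)
pose b y := Num.max 0 (1 - 2 * f y).
have sub : closure [set y | b y != 0] `<=` [set y | f y <= 1/2].
  have cl : closed [set y | f y <= 1/2].
    have -> : [set y | f y <= 1/2] = f @^-1` [set t | t <= 1/2] by [].
    by apply: closed_comp => //; exact: closed_le.
  rewrite ((closure_id _).1 cl).
  apply: closureS => y /=; rewrite /b; apply: contraNT.
  by rewrite -ltNge => h; apply/eqP/max_idPl; lra.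
have sub2 : closure [set y | b y != 0] `<=` O.
  move=> y /sub /= h; apply: contrapT => nOy.
  have : f y = 1 by apply: f1; exists y.
  by lra.
exists b; split.
- move=> y; apply: (@continuous_maxr R T y); first exact: cvg_cst.
  by apply: cvgB; [exact: cvg_cst|apply: cvgM; [exact: cvg_cst|exact: cf]].
- by rewrite /b (_ : f x = 0) ?mulr0 ?subr0; [apply/max_idPr|apply: f0; exists x].
- apply: (subclosed_compact _ cW); first exact: closed_closure.
  by move=> y /sub2 [/interior_subset].
- by move=> y /sub2 [].
Qed.

(** The squares, rather than the functions, sum to 1: each [q] is used twice
    below, once on the left and once on the right, and the bounds [sum q^2 <= 1]
    are what the Cauchy-Schwarz inequality consumes. *)
Lemma square_partition (V : T -> set T) (K : set T) : compact K ->
  (forall x, K x -> open (V x) /\ V x x) ->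
  exists s : seq (T -> R),
    [/\ forall q, q \in s -> continuous q /\ compact (closure [set y | q y != 0])
          /\ exists2 x, K x & closure [set y | q y != 0] `<=` V x,
        forall y, \sum_(q <- s) q y ^+ 2 <= 1 &
        forall y, K y -> \sum_(q <- s) q y ^+ 2 = 1].
Proof.
move=> cK KV.
pose good (q : T -> R) := continuous q /\ compact (closure [set y | q y != 0])
  /\ exists2 x, K x & closure [set y | q y != 0] `<=` V x.
have sq0 (r : seq (T -> R)) y : 0 <= \sum_(q <- r) q y ^+ 2.
  by apply: sumr_ge0 => q _; exact: sqr_ge0.
have [s [gs hs]] : exists s : seq (T -> R), (forall q, q \in s -> good q) /\
    forall y, K y -> 1/2 < \sum_(q <- s) q y ^+ 2.
  apply: (@compact_induction T (fun A => exists s : seq (T -> R),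
    (forall q, q \in s -> good q) /\
    forall y, A y -> 1/2 < \sum_(q <- s) q y ^+ 2)) => //.
  - by exists [::].
  - by move=> A B [s [gs hs]] AB; exists s; split => // y /AB; exact: hs.
  - move=> A B [s [gs hs]] [t [gt ht]]; exists (s ++ t); split.
      by move=> q; rewrite mem_cat => /orP[/gs|/gt].
    move=> y [/hs|/ht] h; rewrite big_cat /=; apply: (lt_le_trans h).
      by rewrite lerDl.
    by rewrite lerDr.
  - move=> x Kx; have [oV Vx] := KV x Kx.
    have [b [cb bx cpt sub]] := exists_bump oV Vx.
    exists [set y | 1/2 < b y ^+ 2].
      have oN : open [set y | 1/2 < b y ^+ 2].
        have -> : [set y | 1/2 < b y ^+ 2] =
          (fun y => b y ^+ 2) @^-1` [set t | 1/2 < t] by [].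
        apply: open_comp; last exact: open_gt.
        by move=> y _; apply: cvgM; exact: cb.
      by apply: open_nbhs_nbhs; split => //=; rewrite bx; lra.
    exists [:: b]; split; last by move=> y /=; rewrite big_seq1.
    by move=> q; rewrite inE => /eqP ->; split => //; split => //; exists x.
(* Where the sum of squares exceeds 1/2, dividing by [sqrt S] makes it equal
   to 1; the maximum keeps the denominator positive elsewhere. *)
pose S y := Num.max (1/2) (\sum_(q <- s) q y ^+ 2).
have S_gt0 y : 0 < S y by rewrite lt_max; apply/orP; left; lra.
have cS : continuous S.
  move=> y; apply: (@continuous_maxr R T y); first exact: cvg_cst.
  apply: continuous_sum => q /gs [cq _].
  by apply: cvgM; exact: cq.
have qE q y : (q y / Num.sqrt (S y)) ^+ 2 = q y ^+ 2 / S y.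
  by rewrite exprMn exprVn sqr_sqrtr // ltW.
exists [seq (fun y => q y / Num.sqrt (S y)) | q <- s]; split.
- move=> _ /mapP[q qs ->]; have [cq [kq [x Kx sub]]] := gs q qs.
  have sub' : closure [set y | q y / Num.sqrt (S y) != 0] `<=`
      closure [set y | q y != 0].
    by apply: closureS => y /=; apply: contra => /eqP ->; rewrite mul0r.
  split; [|split].
  + move=> y; apply: cvgM; first exact: cq.
    apply: cvgV; first by rewrite gt_eqF // sqrtr_gt0.
    by apply: (@continuous_comp _ _ _ S); [exact: cS|exact: sqrt_continuous].
  + by apply: (subclosed_compact _ kq sub'); exact: closed_closure.
  + by exists x => // y /sub' /sub.
- move=> y; rewrite big_map; under eq_bigr do rewrite qE.
  by rewrite -mulr_suml ler_pdivrMr // mul1r le_max lexx orbT.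
- move=> y Ky; rewrite big_map; under eq_bigr do rewrite qE.
  rewrite -mulr_suml /S (max_idPr _) ?divff //; last by rewrite ltW // hs.
  by have := hs y Ky; case: eqP => // -> ; lra.
Qed.

End Bumps.

(** * Complex-valued functions with compact support *)

(** Used to divide: [f] may be multiplied by an inverse that is continuous only
    where [f] lives, because the product vanishes near all other points. *)
Lemma continuous_mul_supp (K : numFieldType) (T : topologicalType)
    (f g : T -> K) :
  continuous f ->
  (forall x, closure [set y | f y != 0] x -> {for x, continuous g}) ->
  continuous (fun x => f x * g x).
Proof.
move=> cf cg x; have [clx|nclx] := pselect (closure [set y | f y != 0] x).
  by apply: cvgM; [exact: cf|exact: cg].
have nx : \forall y \near x, f y = 0.
  have : nbhs x (~` closure [set y | f y != 0]).
    by apply: open_nbhs_nbhs; split => //; exact/closed_openC/closed_closure.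
  apply: filterS => y /= ny; apply/eqP; apply: contrapT => /negP h.
  by apply: ny; exact: subset_closure.
have fx0 : f x = 0 by exact: nbhs_singleton nx.
rewrite /continuous_at /= fx0 mul0r.
have e : {near nbhs x, (fun=> 0 : K) =1 (fun y => f y * g y)}.
  by apply: filterS nx => y /= ->; rewrite mul0r.
by apply: cvg_trans (near_eq_cvg e) _; exact: cvg_cst.
Qed.

Section Modulus.
Variable R : realType.
Implicit Types z w : Cplx R.

Lemma modulusE z : `|z| = (modulus z)%:C%C :> Cplx R.
Proof.
by apply/eqP; rewrite eq_complex /= eqxx /=; case: z.
Qed.

Lemma modulus_ge0 z : 0 <= modulus z.
Proof. by have := normr_ge0 z; rewrite modulusE lecR. Qed.

Lemma modulusM z w : modulus (z * w) = modulus z * modulus w.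
Proof.
apply: (@complexI R).
by rewrite -modulusE normrM !modulusE -rmorphM.
Qed.

Lemma modulus0 : modulus (0 : Cplx R) = 0.
Proof. by rewrite /modulus normr0. Qed.

Lemma modulus_sum (I : Type) (r : seq I) (f : I -> Cplx R) :
  modulus (\sum_(i <- r) f i) <= \sum_(i <- r) modulus (f i).
Proof.
rewrite -lecR -modulusE rmorph_sum; apply: (le_trans (ler_norm_sum _ _ _)).
by apply: ler_sum => i _; rewrite modulusE.
Qed.

Lemma modulus_real (x : R) : modulus (x%:C%C : Cplx R) = `|x|.
Proof. by rewrite /modulus /= expr0n /= addr0 sqrtr_sqr. Qed.

Lemma continuous_real_complex (T : topologicalType) (f : T -> R) (x : T) :
  {for x, continuous f} -> {for x, continuous (fun y => (f y)%:C%C : Cplx R)}.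
Proof.
move=> cf; apply/(@cvgrPdist_lt _ (Cplx R)) => e e0.
have eE : e = (complex.Re e)%:C%C.
  by apply/eqP; rewrite eq_complex /= eqxx /= ; move: e0; rewrite ltcE => /andP[].
have e0' : 0 < complex.Re e by move: e0; rewrite {1}eE ltcR.
have /(@cvgrPdist_lt _ R)/(_ _ e0') := cf.
apply: filterS => y h; rewrite -rmorphB modulusE modulus_real eE ltcR.
exact: h.
Qed.

End Modulus.

Section CompactSupport.
Variables (R : realType) (G : etale_groupoid).
Implicit Types (P : set G) (f g : G -> Cplx R).

Lemma Cc_sub P f g : Cc P f -> continuous g ->
  (forall x, f x = 0 -> g x = 0) -> Cc P g.
Proof.
move=> [cf kf sf] cg fg.
have sub : closure [set x | g x != 0] `<=` closure [set x | f x != 0].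
  by apply: closureS => x /=; apply: contra => /eqP /fg ->.
split => //; last by move=> x /sub /sf.
by apply: (subclosed_compact _ kf sub); exact: closed_closure.
Qed.

Lemma Cc_subset P Q f : P `<=` Q -> Cc P f -> Cc Q f.
Proof. by move=> PQ [cf kf sf]; split => // x /sf /PQ. Qed.

Lemma Cc_mul P f g : Cc P f ->
  (forall x, closure [set y | f y != 0] x -> {for x, continuous g}) ->
  Cc P (fun x => f x * g x).
Proof.
move=> cf cg; apply: (Cc_sub cf) => [|x ->]; last by rewrite mul0r.
by apply: continuous_mul_supp => //; case: cf.
Qed.

Lemma Cc0 P : Cc P (fun=> 0 : Cplx R).
Proof.
have e : [set x : G | (0 : Cplx R) != 0] = set0.
  by apply/seteqP; split => // x /=; rewrite eqxx.
by split; [move=> x; exact: cvg_cst|rewrite e closure0; exact: compact0|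
  rewrite e closure0].
Qed.

Lemma Cc_lin P z f g : Cc P f -> Cc P g -> Cc P (fun x => z * f x + g x).
Proof.
move=> [cf kf sf] [cg kg sg].
have sub : closure [set x | z * f x + g x != 0] `<=`
    closure [set x | f x != 0] `|` closure [set x | g x != 0].
  rewrite -closureU; apply: closureS => x /=.
  have [->|] := eqVneq (f x) 0; last by left.
  by rewrite mulr0 add0r; right.
split; last by move=> x /sub [/sf|/sg].
- move=> x; apply: cvgD; last exact: cg.
  by apply: cvgM; [exact: cvg_cst|exact: cf].
- by apply: (subclosed_compact _ (compactU kf kg) sub); exact: closed_closure.
Qed.

Lemma Cc_sum P (I : eqType) (r : seq I) (F : I -> G -> Cplx R) :
  (forall i, i \in r -> Cc P (F i)) -> Cc P (fun x => \sum_(i <- r) F i x).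
Proof.
elim: r => [_|i r IH cF].
  have -> : (fun x => \sum_(i <- [::]) F i x) = (fun=> 0).
    by apply/funext => x; rewrite big_nil.
  exact: Cc0.
have -> : (fun x => \sum_(k <- i :: r) F k x) =
    (fun x => 1 * F i x + \sum_(k <- r) F k x).
  by apply/funext => x; rewrite big_cons mul1r.
apply: Cc_lin; first by apply: cF; rewrite mem_head.
by apply: IH => k kr; apply: cF; rewrite inE kr orbT.
Qed.

Lemma Cc_real P (q : G -> R) : continuous q ->
  compact (closure [set x | q x != 0]) -> closure [set x | q x != 0] `<=` P ->
  Cc P (fun x => (q x)%:C%C : Cplx R).
Proof.
move=> cq kq sq.
have e : [set x | (q x)%:C%C != 0 :> Cplx R] = [set x | q x != 0].
  by apply/seteqP; split => x /=; rewrite (inj_eq (@complexI R) _ 0).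
by split; rewrite ?e // => x; exact/continuous_real_complex/cq.
Qed.

Lemma Cc_bounded P f : Cc P f ->
  exists2 B : R, 0 <= B & forall x, modulus (f x) <= B.
Proof.
move=> [cf kf _].
have [B B0 hB] : exists2 B : R, 0 <= B &
    forall x, closure [set x | f x != 0] x -> modulus (f x) <= B.
  apply: (compact_induction (P := fun A => exists2 B : R, 0 <= B &
    forall x, A x -> modulus (f x) <= B) kf).
  - by exists 0.
  - by move=> A A' [B B0 hB] AA'; exists B => // x /AA' /hB.
  - move=> A A' [B B0 hB] [B' B'0 hB']; exists (B + B'); first exact: addr_ge0.
    move=> x [/hB|/hB'] h; apply: (le_trans h).
      by rewrite lerDl.
    by rewrite lerDr.
  - move=> x _; exists [set y | `|f x - f y| < 1].
      have := cf x; move=> /(@cvgrPdist_lt _ (Cplx R)); apply; exact: ltr01.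
    exists (modulus (f x) + 1); first by rewrite addr_ge0 ?modulus_ge0.
    move=> y /= h; rewrite -lecR -modulusE rmorphD /= -modulusE.
    have -> : f y = f x - (f x - f y) by rewrite opprB addrC subrK.
    apply: (le_trans (ler_normB _ _)); rewrite lerD2l; exact: ltW.
exists B => // x; have [->|fx] := eqVneq (f x) 0; first by rewrite modulus0.
by apply: hB; apply: subset_closure.
Qed.

End CompactSupport.

(** * Topology and algebra of an etale groupoid *)

Section LocalHomeomorphisms.
Variables (T T' : topologicalType) (B : set T') (f : T -> T').
Hypothesis fP : local_homeomorphism B f.

Lemma local_homeomorphism_continuous : continuous f.
Proof.
move=> x; have [_ /(_ x)[U [oU Ux cU _ _]]] := fP.
move: cU; rewrite (continuous_open_subspace _ oU) => /(_ x).
by apply; rewrite inE.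
Qed.

Lemma local_homeomorphism_open_map (V : set T) :
  open B -> open V -> open (f @` V).
Proof.
move=> oB oV; rewrite openE => _ [x Vx <-].
have [_ /(_ x)[U [oU Ux _ _ hU]]] := fP.
have [W oW e] := hU (V `&` U) (openI oV oU) (@subIsetr _ _ _).
apply: (@filterS _ _ _ (W `&` B)).
  by rewrite -e; exact: image_subset (@subIsetl _ _ _).
apply: open_nbhs_nbhs; split; first exact: openI.
by rewrite -e; exists x.
Qed.

End LocalHomeomorphisms.

Section Groupoid.
Variable G : etale_groupoid.
Implicit Types x y u : G.

Lemma gsrc_continuous : continuous (@gsrc G).
Proof. exact: local_homeomorphism_continuous (@gsrc_local_homeo G). Qed.

Lemma grng_continuous : continuous (@grng G).
Proof. exact: local_homeomorphism_continuous (@grng_local_homeo G). Qed.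

Lemma units_src x : units (gsrc x).
Proof. exact: gsrc_src. Qed.

Lemma units_rng x : units (grng x).
Proof. exact: gsrc_rng. Qed.

Lemma grng_unit u : units u -> grng u = u.
Proof. by move=> uE; rewrite -uE grng_src. Qed.

Lemma ginv_unit u : units u -> ginv u = u.
Proof.
move=> uu; rewrite -[LHS]gmul_rng grng_inv (uu : gsrc u = u) gmul_inv.
exact: grng_unit.
Qed.

(** If [x] and [gsrc x] both lie in a set on which [gsrc] is injective, then
    they are equal, as [gsrc] is idempotent. *)
Lemma units_open : open (@units G).
Proof.
rewrite openE => u uu.
have [_ /(_ u)[U [oU Uu _ injU _]]] := @gsrc_local_homeo G.
have oV : open (U `&` @gsrc G @^-1` U).
  by apply: openI => //; apply: open_comp => // x _; exact: gsrc_continuous.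
apply: (@filterS _ _ _ (U `&` @gsrc G @^-1` U)).
  by move=> x [Ux Usx]; apply: injU; rewrite ?inE // gsrc_src.
by apply: open_nbhs_nbhs; split => //; split => //=; rewrite uu.
Qed.

Lemma gsrc_open_map (V : set G) : open V -> open (@gsrc G @` V).
Proof.
apply: local_homeomorphism_open_map; [exact: gsrc_local_homeo|exact: units_open].
Qed.

Lemma grng_open_map (V : set G) : open V -> open (@grng G @` V).
Proof.
apply: local_homeomorphism_open_map; [exact: grng_local_homeo|exact: units_open].
Qed.

Lemma exists_bisection x :
  exists U : set G, [/\ open U, U x, set_inj U (@gsrc G) & set_inj U (@grng G)].
Proof.
have [_ /(_ x)[U [oU Ux _ iU _]]] := @gsrc_local_homeo G.
have [_ /(_ x)[V [oV Vx _ iV _]]] := @grng_local_homeo G.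
exists (U `&` V); split => //; first exact: openI.
- by apply: sub_in2 iU => y; rewrite !inE; case.
- by apply: sub_in2 iV => y; rewrite !inE; case.
Qed.

Lemma grng_mulV x y : gsrc x = gsrc y -> grng (gmul x (ginv y)) = grng x.
Proof. by move=> e; rewrite grng_mul // grng_inv. Qed.

Lemma gsrc_mulV x y : gsrc x = gsrc y -> gsrc (gmul x (ginv y)) = grng y.
Proof. by move=> e; rewrite gsrc_mul ?grng_inv // gsrc_inv. Qed.

Lemma gmulVK x y : gsrc x = gsrc y -> gmul (gmul x (ginv y)) y = x.
Proof.
move=> e; rewrite -gmulA ?grng_inv ?gsrc_inv // ginv_mul -e; exact: gmul_src.
Qed.

Lemma gmulV_unit x y : gsrc x = gsrc y -> units (gmul x (ginv y)) -> x = y.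
Proof.
move=> e u; rewrite -{1}(gmulVK e).
rewrite -(grng_unit u) grng_mulV // -(grng_mulV e) (grng_unit u).
by rewrite -(u : gsrc _ = _) gsrc_mulV // gmul_rng.
Qed.

(** The product of [x] and the inverse of [y] has equal range and source, so it is
    a unit. This is the form in which principality is used. *)
Lemma principal_inj x y : principal G -> gsrc x = gsrc y ->
  grng x = grng y -> x = y.
Proof.
move=> pG e e'; apply: gmulV_unit => //; apply: pG.
by rewrite grng_mulV // gsrc_mulV.
Qed.

Lemma gmulV_inj x : set_inj (src_fiber (gsrc x)) (fun y => gmul x (ginv y)).
Proof.
move=> y z; rewrite !inE /src_fiber /= => sy sz e.
have ey : gmul (ginv x) (gmul x (ginv y)) = ginv y.
  by rewrite gmulA ?grng_inv ?gsrc_inv // ginv_mul -sy -grng_inv gmul_rng.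
have ez : gmul (ginv x) (gmul x (ginv z)) = ginv z.
  by rewrite gmulA ?grng_inv ?gsrc_inv // ginv_mul -sz -grng_inv gmul_rng.
have ginvK w : ginv (ginv w) = w.
  rewrite -[LHS]gmul_src gsrc_inv grng_inv -ginv_mul.
  rewrite gmulA ?ginv_mul ?gsrc_inv ?grng_inv //.
  by rewrite gmul_rng.
by rewrite -[y]ginvK -[z]ginvK -ey -ez e.
Qed.

End Groupoid.

(** Transport of [psi] along the homeomorphism [t : U -> t(U)]. For [t] the range
    or the source map this turns a function on a bisection into one on the unit
    space, that is, into an element of the diagonal. *)
Lemma exists_pushforward (R : realType) (G : etale_groupoid) (t : G -> G)
    (U : set G) (psi : G -> Cplx R) :
  continuous t -> (forall V : set G, open V -> open (t @` V)) -> open U ->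
  set_inj U t -> Cc U psi ->
  exists h : G -> Cplx R, [/\ Cc (t @` U) h,
    forall x, U x -> h (t x) = psi x &
    forall v, h v != 0 -> exists2 x, psi x != 0 & t x = v].
Proof.
move=> ct ot oU injU [cpsi kpsi spsi].
(* On [t(U)] this is [psi] composed with the inverse of [t], which is
   continuous because [t] is open; off the closed set [t(supp psi)] it is
   locally zero. These two open sets cover [G]. *)
pose h (v : G) : Cplx R :=
  if pselect (exists x, U x /\ t x = v) is left e then psi (projT1 (cid e)) else 0.
have hE x : U x -> h (t x) = psi x.
  move=> Ux; rewrite /h; case: pselect => [e|[]]; last by exists x.
  case: cid => y /= [Uy tyx]; congr psi; apply: injU; rewrite ?inE //.
have h0 v : h v != 0 -> exists2 x, psi x != 0 & t x = v.
  rewrite /h; case: pselect => [e|]; last by rewrite eqxx.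
  by case: cid => y /= [Uy tyx] py; exists y.
set K := closure [set x | psi x != 0] in kpsi spsi.
have kK : compact (t @` K).
  by apply: continuous_compact => //; exact: continuous_subspaceT.
have clK : closed (t @` K) by apply: compact_closed => //; exact: g_hausdorff.
have sub : closure [set v | h v != 0] `<=` t @` K.
  rewrite ((closure_id _).1 clK); apply: closureS => v /= /h0[x px <-].
  by exists x => //; exact: subset_closure.
exists h; split; [split|exact: hE|exact: h0].
- move=> v; have [[x [Ux txv]]|nv] := pselect (exists x, U x /\ t x = v).
    rewrite /continuous_at -txv (hE x Ux) => N /cpsi.
    rewrite nbhsE; case=> W [oW Wx] WN.
    apply: (@filterS _ _ _ (t @` (W `&` U))).
      by move=> _ [y [Wy Uy] <-] /=; rewrite hE //; exact: WN.
    apply: open_nbhs_nbhs; split; first by apply: ot; exact: openI.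
    by exists x.
  have nK : ~ (t @` K) v.
    by move=> [x Kx txv]; apply: nv; exists x; split; [exact: spsi|].
  have e : {near nbhs v, (fun=> 0 : Cplx R) =1 h}.
    have : nbhs v (~` (t @` K)).
      by apply: open_nbhs_nbhs; split => //; exact: closed_openC.
    apply: filterS => w nw; apply/esym/eqP; apply: contrapT => /negP hw; apply: nw.
    by apply: sub; exact: subset_closure.
  rewrite /continuous_at (_ : h v = 0); last by rewrite -(nbhs_singleton e).
  by apply: cvg_trans (near_eq_cvg e) _; exact: cvg_cst.
- by apply: (subclosed_compact _ kK sub); exact: closed_closure.
- by move=> v /sub [x /spsi Ux <-]; exists x.
Qed.

(** * The row-column bound for the reduced norm *)

Lemma cauchy_schwarz_sum (R : realFieldType) (I : Type) (r : seq I)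
    (a b : I -> R) :
  (\sum_(i <- r) a i * b i) ^+ 2 <=
  (\sum_(i <- r) a i ^+ 2) * (\sum_(i <- r) b i ^+ 2).
Proof.
elim: r => [|i r IH]; first by rewrite !big_nil expr0n mul0r.
rewrite !big_cons; move: IH.
have := sumr_ge0 r (P := xpredT)
  (F := fun i => a i ^+ 2) (fun i _ => sqr_ge0 (a i)).
have := sumr_ge0 r (P := xpredT)
  (F := fun i => b i ^+ 2) (fun i _ => sqr_ge0 (b i)).
move: (\sum_(j <- r) b j ^+ 2) (\sum_(j <- r) a j ^+ 2) => B A.
move: (\sum_(j <- r) a j * b j) => C B0 A0 CAB.
set x := a i; set y := b i.
(* The cross term: its square is at most [4 (x y)^2 A B], which is at most the
   square of the right-hand side. *)
suff h : 2 * x * y * C <= x ^+ 2 * B + y ^+ 2 * A by nra.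
have h0 : 0 <= x ^+ 2 * B + y ^+ 2 * A.
  by apply: addr_ge0; apply: mulr_ge0 => //; exact: sqr_ge0.
apply: (le_trans (ler_norm _)); rewrite -ler_sqr ?nnegrE // -normrX.
rewrite ger0_norm ?sqr_ge0 //.
have hxy : 0 <= (x * y) ^+ 2 by exact: sqr_ge0.
have := ler_wpM2l hxy CAB.
have := sqr_ge0 (x ^+ 2 * B - y ^+ 2 * A); nra.
Qed.

Section EsumScaling.
Variables (R : realType) (T : choiceType).
Local Open Scope ereal_scope.

Lemma le_esumZl (S : set T) (c : R) (a : T -> \bar R) : (0 <= c)%R ->
  (forall x, 0 <= a x) ->
  \esum_(x in S) (c%:E * a x) <= c%:E * \esum_(x in S) a x.
Proof.
move=> c0 a0; apply: ge_ereal_sup => _ [X [fX XS] <-].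
rewrite -ge0_mule_fsumr //; apply: lee_wpmul2l; first by rewrite lee_fin.
by apply: ereal_sup_ubound; exists X.
Qed.

End EsumScaling.

Section FiberSums.
Variables (R : realType) (G : etale_groupoid).
Implicit Types (u x y : G) (f g xi : G -> Cplx R).

(** Range fibers are discrete, since a bisection meets each of them at most
    once. *)
Lemma compact_rng_fiber_finite (K : set G) (v : G) :
  compact K -> finite_set (K `&` [set z | grng z = v]).
Proof.
move=> cK.
apply: (compact_induction
  (P := fun A => finite_set (A `&` [set z | grng z = v])) cK).
- by rewrite set0I; exact: finite_set0.
- by move=> A B fB AB; apply: sub_finite_set fB; exact: setSI.
- by move=> A B fA fB; rewrite setIUl finite_setU.
- move=> x _; have [U [oU Ux _ iU]] := exists_bisection x.
  exists U; first exact: open_nbhs_nbhs.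
  have [[z [Uz zv]]|nz] := pselect (exists z, (U `&` [set z | grng z = v]) z).
    apply: (@sub_finite_set _ _ [set z]); last exact: finite_set1.
    by move=> w [Uw wv]; apply: iU; rewrite ?inE // wv zv.
  by apply: (@sub_finite_set _ _ set0) => // w Uw; apply: nz; exists w.
Qed.

(** Finite sums over an infinite support are zero by convention; this finiteness
    is what makes the sums defining [Ind] behave additively. *)
Lemma finite_translate_supp (P : set G) g x : Cc P g ->
  finite_set (src_fiber (gsrc x) `&` [set y | g (gmul x (ginv y)) != 0]).
Proof.
move=> [_ kg _].
set D := _ `&` _; pose t y := gmul x (ginv y).
have inj : {in D &, injective t}.
  by move=> y z; rewrite !inE => -[sy _] [sz _]; apply: gmulV_inj; rewrite inE.
have fi : finite_set (t @` D).
  apply: sub_finite_set (compact_rng_fiber_finite (grng x) kg).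
  move=> _ [y [sy gy] <-]; split; first exact: subset_closure.
  by rewrite /t /= grng_mulV.
by rewrite -(eq_finite_set (inj_card_eq inj)).
Qed.

Lemma convolution_unitl f g x : (forall y, f y != 0 -> units y) ->
  convolution f g x = f (grng x) * g x.
Proof.
move=> fu; rewrite /convolution -(fsbig_widen [set x]) ?fsbig_set1 ?gmul_inv //.
  by move=> _ ->.
move=> y [sy yx]; rewrite /preimage /=.
have [->|/fu uy] := eqVneq (f (gmul x (ginv y))) 0; first by rewrite mul0r.
by case: yx; rewrite /= (gmulV_unit _ uy).
Qed.

Lemma convolution_unitr f g x : (forall y, g y != 0 -> units y) ->
  convolution f g x = f x * g (gsrc x).
Proof.
move=> gu; rewrite /convolution -(fsbig_widen [set gsrc x]) ?fsbig_set1.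
- by rewrite ginv_unit ?gmul_src //; exact: units_src.
- by move=> _ ->; exact: gsrc_src.
- move=> y [sy yx]; rewrite /preimage /=.
  have [->|/gu uy] := eqVneq (g y) 0; first by rewrite mulr0.
  by case: yx; rewrite /= -sy uy.
Qed.

End FiberSums.

Section RowColumn.
Variables (R : realType) (G : etale_groupoid).
Implicit Types (u x y : G) (f g xi : G -> Cplx R).
Local Open Scope ereal_scope.

(** Squares are kept in the extended reals: sums over fibers can then be
    interchanged without summability side conditions, and only [l2norm_le] has
    to deal with the exponent of [l2norm]. *)
Definition l2sq u xi : \bar R :=
  \esum_(x in src_fiber u) (modulus (xi x) ^+ 2)%:E.

Lemma l2sq_ge0 u xi : 0 <= l2sq u xi.
Proof. by apply: esum_ge0 => x _; rewrite lee_fin sqr_ge0. Qed.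

Lemma l2norm_le u xi (N : R) : (0 <= N)%R ->
  (l2norm u xi <= N%:E) = (l2sq u xi <= (N ^+ 2)%:E).
Proof.
move=> N0; rewrite /l2norm -/(l2sq u xi) poweR12_sqrt ?l2sq_ge0 //.
rewrite -(@lee_sqrt _ (l2sq u xi) (N ^+ 2)%:E) ?lee_fin ?sqr_ge0 //.
by rewrite EFin_expe sqrte_sqr gee0_abs.
Qed.

Lemma l2sq_scale u (c : R) xi :
  l2sq u (fun x => (c%:C%C : Cplx R) * xi x)%R <= (c ^+ 2)%:E * l2sq u xi.
Proof.
apply: le_trans (le_esumZl _ (sqr_ge0 c) _); last first.
  by move=> x; rewrite lee_fin sqr_ge0.
apply: le_esum => x _.
by rewrite modulusM modulus_real exprMn -normrX ger0_norm ?sqr_ge0 // EFinM.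
Qed.

Lemma Ind_scale u g (c : Cplx R) xi x :
  Ind u g (fun y => c * xi y)%R x = (c * Ind u g xi x)%R.
Proof.
rewrite /Ind mulr_fsumr; apply: eq_fsbigr => y _.
by rewrite mulrCA.
Qed.

(** From the unit ball to all square-summable vectors. Rescaling fails for a
    vector of norm 0, which vanishes on the fiber. *)
Lemma Ind_bound u g (N : R) xi : (0 <= N)%R -> Ind_norm u g <= N%:E ->
  l2sq u xi < +oo -> l2sq u (Ind u g xi) <= (N ^+ 2)%:E * l2sq u xi.
Proof.
move=> N0 gN xifin.
have := l2sq_ge0 u xi; case Ee: (l2sq u xi) xifin => [e| |] // _.
rewrite lee_fin le_eqVlt => /predU1P[e0|e0].
  have xi0 x : src_fiber u x -> xi x = 0%R.
    move=> ux; apply/eqP; apply: contrapT => /negP xix.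
    have : (modulus (xi x) ^+ 2)%:E <= l2sq u xi.
      apply: esum_ge; exists [set x]; last by rewrite fsbig_set1.
      by split; [exact: finite_set1|move=> _ ->].
    rewrite Ee -e0 lee_fin; apply/negP; rewrite -ltNge exprn_gt0 //.
    rewrite lt_neqAle modulus_ge0 andbT eq_sym; apply: contra xix => /eqP m0.
    by rewrite -normr_eq0 modulusE m0.
  rewrite -e0 mule0 /l2sq esum1 // => x _.
  rewrite /Ind fsbig1 ?modulus0 ?expr0n // => y /xi0 ->.
  by rewrite mulr0.
set c := Num.sqrt e.
have c0 : (0 < c)%R by rewrite sqrtr_gt0.
have cE : (c ^+ 2 = e)%R by rewrite sqr_sqrtr // ltW.
pose xi' x := ((c^-1)%:C%C * xi x)%R : Cplx R.
have le1 : l2norm u xi' <= 1.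
  rewrite l2norm_le ?ler01 // expr1n; apply: (le_trans (l2sq_scale _ _ _)).
  by rewrite Ee -EFinM lee_fin exprVn cE mulVf ?gt_eqF.
have leN : l2sq u (Ind u g xi') <= (N ^+ 2)%:E.
  rewrite -l2norm_le //; apply: le_trans gN.
  by apply: ereal_sup_ubound; exists xi'.
have -> : Ind u g xi = (fun x => c%:C%C * Ind u g xi' x)%R.
  apply/funext => x; rewrite Ind_scale mulrA -rmorphM divff ?gt_eqF //.
  by rewrite rmorph1 mul1r.
apply: (le_trans (l2sq_scale _ _ _)); rewrite cE muleC.
by apply: lee_wpmul2r => //; rewrite lee_fin ltW.
Qed.

Section Family.
Variables (I : choiceType) (r : seq I) (h k : I -> G -> Cplx R).
Variable g : G -> Cplx R.
Hypothesis cg : Cc setT g.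

(* The kernel of the operator [sum_i h_i g k_i], where [h_i] and [k_i] are seen
   as elements of the diagonal. *)
Let m x := (\sum_(i <- r) h i (grng x) * g x * k i (gsrc x))%R.

Lemma Ind_row_column u xi x : src_fiber u x ->
  Ind u m xi x =
  (\sum_(i <- r) h i (grng x) * Ind u g (fun y => k i (grng y) * xi y) x)%R.
Proof.
move=> ux; have fD := finite_translate_supp x cg.
rewrite [gsrc x]ux in fD; set D := _ `&` _ in fD.
have IndE f xi' : (forall y, g y = 0 -> f y = 0)%R ->
  Ind u f xi' x = (\sum_(y <- fset_set D) f (gmul x (ginv y)) * xi' y)%R.
  move=> fg; rewrite /Ind -fsbig_finite //; apply/esym/fsbig_widen.
    by move=> y [].
  move=> y [uy nD] /=; rewrite fg ?mul0r //.
  by apply/eqP; apply: contrapT => /negP gy; apply: nD.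
rewrite IndE; last first.
  by move=> y gy; rewrite /m big1 // => i _; rewrite gy mulr0 mul0r.
under eq_bigr do rewrite /m mulr_suml.
rewrite exchange_big /=; apply: eq_bigr => i _.
rewrite IndE // mulr_sumr [LHS]big_seq [RHS]big_seq; apply: eq_bigr => y.
rewrite in_fset_set // => /set_mem[uy _].
rewrite grng_mulV ?gsrc_mulV ?[gsrc x]ux ?[gsrc y]uy //.
by rewrite !mulrA.
Qed.

(** In the regular representation at [u], Cauchy-Schwarz in the index [i] bounds
    the square of the [x]-entry of [sum_i h_i g (k_i xi)] by
    [B^2 sum_i |(g (k_i xi))(x)|^2]. Summing over [x] gives at most
    [B^2 N^2 sum_i |k_i xi|^2], and the sum of squares of the [k_i] absorbs the
    last sum. The bound does not depend on the number of terms. *)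
Lemma red_norm_row_column (B N : R) : (0 <= B)%R -> (0 <= N)%R ->
  (forall v, units v -> \sum_(i <- r) modulus (h i v) ^+ 2 <= B ^+ 2)%R ->
  (forall v, units v -> \sum_(i <- r) modulus (k i v) ^+ 2 <= 1)%R ->
  red_norm g <= N%:E -> red_norm m <= (B * N)%:E.
Proof.
move=> B0 N0 hB k1 gN.
have BN0 : (0 <= B * N)%R by exact: mulr_ge0.
apply: ge_ereal_sup => _ [->|[u uu <-]]; first by rewrite lee_fin.
have guN : Ind_norm u g <= N%:E.
  by apply: le_trans gN; apply: ereal_sup_ubound; right; exists u.
apply: ge_ereal_sup => _ [xi /= xi1 <-].
have sq1 : l2sq u xi <= 1 by move: xi1; rewrite l2norm_le ?ler01 // expr1n.
rewrite l2norm_le //.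
pose xik i y := (k i (grng y) * xi y)%R.
have sum_le : \sum_(i <- r) l2sq u (xik i) <= 1.
  apply: le_trans sq1; rewrite /l2sq -esum_sum; last first.
    by move=> x i _ _; rewrite lee_fin sqr_ge0.
  apply: le_esum => x _; rewrite sumEFin lee_fin.
  under eq_bigr do rewrite /xik modulusM exprMn.
  rewrite -mulr_suml ler_piMl ?sqr_ge0 //; exact/k1/units_rng.
have fin i : i \in r -> l2sq u (xik i) < +oo.
  move=> ir; apply: le_lt_trans (ltry 1); apply: le_trans sum_le.
  rewrite (big_rem i ir) /=; apply: leeDl; apply: sume_ge0 => j _.
  exact: l2sq_ge0.
apply: (@le_trans _ _ ((B ^+ 2)%:E * \sum_(i <- r) l2sq u (Ind u g (xik i)))).
  rewrite /l2sq -esum_sum; last by move=> x i _ _; rewrite lee_fin sqr_ge0.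
  apply: le_trans (le_esumZl _ (sqr_ge0 B) _); last first.
    by move=> x; apply: sume_ge0 => i _; rewrite lee_fin sqr_ge0.
  apply: le_esum => x ux; rewrite Ind_row_column // sumEFin -EFinM lee_fin.
  apply: (@le_trans _ _ ((\sum_(i <- r) modulus (h i (grng x)) *
      modulus (Ind u g (xik i) x)) ^+ 2)%R).
    rewrite ler_sqr ?nnegrE ?modulus_ge0 //; last first.
      by apply: sumr_ge0 => i _; rewrite mulr_ge0 ?modulus_ge0.
    apply: (le_trans (modulus_sum _ _)); apply: ler_sum => i _.
    by rewrite modulusM.
  apply: (le_trans (cauchy_schwarz_sum _ _ _)); apply: ler_wpM2r.
    by apply: sumr_ge0 => i _; rewrite sqr_ge0.
  exact/hB/units_rng.
rewrite exprMn [leRHS]EFinM; apply: lee_wpmul2l; first by rewrite lee_fin sqr_ge0.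
apply: (@le_trans _ _ ((N ^+ 2)%:E * \sum_(i <- r) l2sq u (xik i))).
  rewrite ge0_sume_distrr; last by move=> i _; exact: l2sq_ge0.
  rewrite big_seq [leRHS]big_seq; apply: lee_sum => i ir.
  by apply: Ind_bound => //; exact: fin.
by rewrite -[leRHS]mule1; apply: lee_wpmul2l => //; rewrite lee_fin sqr_ge0.
Qed.

End Family.
End RowColumn.

(** * Pointwise multipliers implemented by the diagonal *)

Section Multipliers.
Variables (R : realType) (G : etale_groupoid).
Hypothesis pG : principal G.

(** An arrow [y] of [C] outside [U] is not [x], hence its range or its source
    differs from that of [x]; the Hausdorff property separates them on a
    neighbourhood of [y] and one of [x], and finitely many of the former cover
    the part of [C] outside [U]. *)
Lemma separated_neighbourhood (C U : set G) (x : G) : compact C -> open U -> U x ->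
  exists W : set G, [/\ open W, W x, W `<=` U &
    forall y w w', C y -> W w -> W w' -> grng y = grng w -> gsrc y = gsrc w' ->
      U y].
Proof.
move=> cC oU Ux.
have cD : compact (C `&` ~` U) by apply: compact_closedI => //; exact: open_closedC.
have [W xW hW] : exists2 W, nbhs x W & forall y, (C `&` ~` U) y ->
    forall w w', W w -> W w' -> grng y = grng w -> gsrc y = gsrc w' -> False.
  apply: (compact_induction (P := fun D => exists2 W, nbhs x W &
    forall y, D y -> forall w w', W w -> W w' ->
      grng y = grng w -> gsrc y = gsrc w' -> False) cD).
  - by exists setT => //; exact: filterT.
  - by move=> A B [W xW hW] AB; exists W => // y /AB; exact: hW.
  - move=> A B [W xW hW] [W' xW' hW']; exists (W `&` W'); first exact: filterI.
    by move=> y [Ay|By] w w' [? ?] [? ?]; [exact: (hW y Ay)|exact: (hW' y By)].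
  - move=> y [_ nUy].
    have sep (t : G -> G) : continuous t -> t y != t x ->
        exists N W : set G, [/\ nbhs y N, nbhs x W &
          forall z w, N z -> W w -> t z != t w].
      move=> ct; have := @g_hausdorff G; rewrite open_hausdorff => hG.
      move=> /hG[[A B] /= [yA xB] [oA oB /eqP AB]].
      exists (t @^-1` A), (t @^-1` B); split.
      + by apply: ct; apply: open_nbhs_nbhs; split => //; exact: set_mem.
      + by apply: ct; apply: open_nbhs_nbhs; split => //; exact: set_mem.
      + move=> z w /= Az Bw; apply/eqP => e; suff : (A `&` B) (t z) by rewrite AB.
        by split => //; rewrite e.
    have [e|ne] := eqVneq (grng y) (grng x).
      have ne : gsrc y != gsrc x.
        by apply/eqP => e'; apply: nUy; rewrite (principal_inj pG e' e).
      have [N [W [yN xW NW]]] := sep _ (@gsrc_continuous G) ne.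
      exists N => //; exists W => // z Nz w w' Ww Ww' _ /eqP.
      exact/negP/NW.
    have [N [W [yN xW NW]]] := sep _ (@grng_continuous G) ne.
    exists N => //; exists W => // z Nz w w' Ww Ww' /eqP + _.
    exact/negP/NW.
have [W' [oW' W'x] W'W] : exists2 W', open_nbhs x W' & W' `<=` W.
  by move: xW; rewrite nbhsE.
exists (W' `&` U); split => //; first exact: openI.
move=> y w w' Cy [W'w _] [W'w' _] e e'; apply: contrapT => nUy.
by apply: (hW y (conj Cy nUy) w w') => //; exact: W'W.
Qed.

(** Each [q] of a square partition subordinate to the neighbourhoods above is
    used twice: [h q] is [phi * q] read at ranges and [k q] is [q] read at
    sources. An arrow [y] of [C] outside [U] for which both factors are nonzero
    would have the range of some [w] and the source of some [w'], both in the
    support of the same [q], which [separated_neighbourhood] excludes. The bounds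
    depend neither on [C] nor on the length of [r]. *)
Lemma exists_multipliers (U C : set G) (phi : G -> Cplx R) (B : R) :
  open U -> set_inj U (@gsrc G) -> set_inj U (@grng G) -> Cc U phi ->
  (forall x, modulus (phi x) <= B) -> compact C ->
  exists (r : seq (G -> R)) (h k : (G -> R) -> G -> Cplx R),
  [/\ forall q, q \in r -> Cc (@units G) (h q) /\ Cc (@units G) (k q),
      forall v, \sum_(q <- r) modulus (h q v) ^+ 2 <= B ^+ 2,
      forall v, \sum_(q <- r) modulus (k q v) ^+ 2 <= 1 &
      forall x, C x -> \sum_(q <- r) h q (grng x) * k q (gsrc x) = phi x].
Proof.
move=> oU isU irU cphi phiB cC; have [_ kphi sphi] := cphi.
set K := closure [set x | phi x != 0] in kphi sphi.
have phi0 x : ~ K x -> phi x = 0.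
  by move=> nK; apply/eqP; apply: contrapT => /negP p; apply/nK/subset_closure.
have /choice[W hW] : forall x, exists W : set G, K x -> [/\ open W, W x, W `<=` U &
    forall y w w', C y -> W w -> W w' -> grng y = grng w -> gsrc y = gsrc w' ->
      U y].
  move=> x; have [Kx|nKx] := pselect (K x); last by exists set0.
  by have [W hW] := separated_neighbourhood cC oU (sphi _ Kx); exists W.
have [r [rP r1 rK]] := square_partition R (@g_locally_compact G) (@g_hausdorff G)
  kphi (fun x Kx => let: And4 o xW _ _ := hW x Kx in conj o xW).
have qE (q : G -> R) x : q x != 0 -> closure [set y | q y != 0] x.
  by move=> qx; exact: subset_closure.
have /choice[hk hkP] : forall q : G -> R,
  exists hk : (G -> Cplx R) * (G -> Cplx R),
    q \in r -> [/\ Cc (@grng G @` U) hk.1,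
      forall x, U x -> hk.1 (grng x) = phi x * (q x)%:C%C,
      forall v, hk.1 v != 0 -> exists2 x, phi x * (q x)%:C%C != 0 & grng x = v &
      [/\ Cc (@gsrc G @` U) hk.2,
      forall x, U x -> hk.2 (gsrc x) = (q x)%:C%C &
      forall v, hk.2 v != 0 -> exists2 x, (q x)%:C%C != 0 :> Cplx R & gsrc x = v]].
  move=> q; have [qr|] := boolP (q \in r); last by exists (phi, phi).
  have [cq [kq [x Kx sq]]] := rP q qr; have [_ _ WU _] := hW x Kx.
  have cq' : Cc U (fun y => (q y)%:C%C : Cplx R).
    by apply: Cc_real => // y /sq /WU.
  have cpq : Cc U (fun y => phi y * (q y)%:C%C).
    by apply: Cc_mul => // y _; exact/continuous_real_complex/cq.
  have [h [h1 h2 h3]] := exists_pushforward (@grng_continuous G)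
    (@grng_open_map G) oU irU cpq.
  have [k [k1 k2 k3]] := exists_pushforward (@gsrc_continuous G)
    (@gsrc_open_map G) oU isU cq'.
  by exists (h, k).
have qU q x : q \in r -> q x != 0 -> U x.
  move=> qr qx; have [_ [_ [z Kz sq]]] := rP q qr.
  by have [_ _ WU _] := hW z Kz; apply/WU/sq/qE.
have rC (a : R) : (a%:C%C == 0 :> Cplx R) = (a == 0).
  by rewrite (inj_eq (@complexI R) _ 0).
exists r, (fun q => (hk q).1), (fun q => (hk q).2); split.
- move=> q /hkP[c1 _ _ [c2 _ _]]; split.
    by apply: Cc_subset c1 => _ [x _ <-]; exact: units_rng.
  by apply: Cc_subset c2 => _ [x _ <-]; exact: units_src.
- move=> v; have [[x Ux <-]|nv] := pselect ((@grng G @` U) v).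
    rewrite big_seq (eq_bigr (fun q => modulus (phi x) ^+ 2 * q x ^+ 2)); last first.
      move=> q /hkP[_ -> // _ _].
      by rewrite modulusM modulus_real exprMn real_normK ?num_real.
    rewrite -big_seq -mulr_sumr; apply: (@le_trans _ _ (modulus (phi x) ^+ 2)).
      by rewrite ler_piMr ?sqr_ge0.
    by rewrite lerXn2r ?nnegrE ?modulus_ge0 ?(le_trans (modulus_ge0 (phi x)) _).
  rewrite big_seq big1 ?sqr_ge0 // => q qr; have [_ _ h0 _] := hkP q qr.
  suff -> : (hk q).1 v = 0 by rewrite modulus0 expr0n.
  apply/eqP; apply: contrapT => /negP /h0[x]; rewrite mulf_eq0 negb_or rC.
  by move=> /andP[_ /(qU _ _ qr) Ux] xv; apply: nv; exists x.
- move=> v; have [[x Ux <-]|nv] := pselect ((@gsrc G @` U) v).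
    rewrite big_seq (eq_bigr (fun q => q x ^+ 2)); last first.
      move=> q /hkP[_ _ _ [_ -> // _]].
      by rewrite modulus_real real_normK ?num_real.
    by rewrite -big_seq.
  rewrite big_seq big1 ?ler01 // => q qr; have [_ _ _ [_ _ k0]] := hkP q qr.
  suff -> : (hk q).2 v = 0 by rewrite modulus0 expr0n.
  apply/eqP; apply: contrapT => /negP /k0[x]; rewrite rC.
  by move=> /(qU _ _ qr) Ux xv; apply: nv; exists x.
- move=> x Cx; have [Ux|nUx] := pselect (U x).
    rewrite big_seq (eq_bigr (fun q => phi x * (q x ^+ 2)%:C%C)); last first.
      move=> q /hkP[_ -> // _ [_ -> // _]].
      by rewrite rmorphXn expr2 mulrA.
    rewrite -big_seq -mulr_sumr -rmorph_sum.
    have [Kx|nKx] := pselect (K x); first by rewrite rK // rmorph1 mulr1.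
    by rewrite phi0 // mul0r.
  rewrite phi0 => [|/sphi //]; rewrite big_seq big1 // => q qr.
  have [_ _ h0 [_ _ k0]] := hkP q qr.
  apply/eqP; apply: contrapT => /negP; rewrite mulf_eq0 negb_or.
  move=> /andP[/h0[w + wx] /k0[w' + w'x]].
  rewrite mulf_eq0 negb_or !rC => /andP[_ qw] qw'.
  have [_ [_ [z Kz sq]]] := rP q qr; have [_ _ _ hz] := hW z Kz.
  by apply: nUx; apply: (hz x w w') => //; exact/sq/qE.
Qed.

End Multipliers.

(** * Truncation maps on the reduced algebra *)

Section RealNorm.
Variables (R : realType) (V : normedModType (Cplx R)).
Implicit Types a b c : V.

(** The norm of a complex normed space takes its values in the complex numbers,
    which are only partially ordered; estimates are carried out on its real
    part. *)
Definition rnorm a : R := complex.Re `|a|.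

Lemma rnormE a : `|a| = (rnorm a)%:C%C :> Cplx R.
Proof.
have : 0 <= `|a| by exact: normr_ge0.
rewrite /rnorm; case: `|a| => x y; rewrite lecE /= => /andP[/eqP -> _].
by [].
Qed.

Lemma rnorm_ge0 a : 0 <= rnorm a.
Proof. by have := normr_ge0 a; rewrite rnormE lecR. Qed.

Lemma rnormD a b : rnorm (a + b) <= rnorm a + rnorm b.
Proof. by rewrite -lecR rmorphD /= -!rnormE; exact: ler_normD. Qed.

Lemma rnormB a b : rnorm (a - b) = rnorm (b - a).
Proof. by rewrite /rnorm distrC. Qed.

Lemma rnorm_sum (I : Type) (r : seq I) (f : I -> V) :
  rnorm (\sum_(i <- r) f i) <= \sum_(i <- r) rnorm (f i).
Proof.
elim: r => [|i r IH]; first by rewrite !big_nil /rnorm normr0.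
by rewrite !big_cons; apply: (le_trans (rnormD _ _)); rewrite lerD2l.
Qed.

Lemma closure_rnorm (S : set V) a :
  closure S a <-> forall e : R, 0 < e -> exists2 b, S b & rnorm (a - b) < e.
Proof.
split=> [cl e e0|h N].
  have e0' : 0 < e%:C%C :> Cplx R by rewrite ltcR.
  have [b [Sb]] := cl _ (nbhsx_ballx a e%:C%C e0').
  rewrite -ball_normE /ball_ /= rnormE ltcR => ab; by exists b.
move=> /nbhs_ballP[e /= e0 eN].
have eE : e = (complex.Re e)%:C%C.
  by apply/eqP; rewrite eq_complex /= eqxx /=; move: e0; rewrite ltcE => /andP[].
have e0' : 0 < complex.Re e by move: e0; rewrite {1}eE ltcR.
have [b Sb ab] := h _ e0'; exists b; split => //; apply: eN.
by rewrite -ball_normE /ball_ /= rnormE eE ltcR.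
Qed.

End RealNorm.

Section ReducedAlgebra.
Variables (R : realType) (G : etale_groupoid) (A : reduced_cstar R G).
Implicit Types (f g : G -> Cplx R) (a b c : A) (M : set A).

Lemma rnorm_mul a b : rnorm (cs_mul a b) <= rnorm a * rnorm b.
Proof. by rewrite -lecR rmorphM /= -!rnormE; exact: cs_norm_mul. Qed.

Lemma Cc_dense a (d : R) : 0 < d ->
  exists2 g, Cc setT g & rnorm (a - rc_in A g) < d.
Proof.
have : closure (rc_in A @` Cc setT) a by rewrite rc_in_dense.
by move=> /closure_rnorm cl /cl[_ [g cg <-] ag]; exists g.
Qed.

Lemma rnorm_in f : Cc setT f -> (rnorm (rc_in A f))%:E = red_norm f.
Proof. exact: rc_in_norm. Qed.

Lemma rc_inB f g : Cc setT f -> Cc setT g ->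
  rc_in A (fun x => f x - g x) = rc_in A f - rc_in A g.
Proof.
move=> cf cg; have := rc_in_linear A (-1) cg cf.
rewrite scaleN1r addrC => <-; congr rc_in; apply/funext => x.
by rewrite mulN1r addrC.
Qed.

Lemma rc_in0 : rc_in A (fun=> 0) = 0.
Proof.
have c0 := @Cc0 R G setT; rewrite -[RHS](subrr (rc_in A (fun=> 0))) -rc_inB //.
by congr rc_in; apply/funext => x; rewrite subrr.
Qed.

Lemma rc_in_sum (I : eqType) (r : seq I) (F : I -> G -> Cplx R) :
  (forall i, i \in r -> Cc setT (F i)) ->
  rc_in A (fun x => \sum_(i <- r) F i x) = \sum_(i <- r) rc_in A (F i).
Proof.
elim: r => [_|i r IH cF].
  rewrite big_nil -rc_in0; congr rc_in; apply/funext => x; exact: big_nil.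
have cr j : j \in r -> Cc setT (F j) by move=> jr; apply: cF; rewrite inE jr orbT.
have ci : Cc setT (F i) by apply: cF; exact: mem_head.
rewrite big_cons -IH // -[rc_in A (F i)]scale1r -rc_in_linear //;
  last exact: Cc_sum.
by congr rc_in; apply/funext => x; rewrite big_cons mul1r.
Qed.

(** Elements of the diagonal act on functions by pointwise multiplication, on the
    left through the range and on the right through the source. *)
Lemma rc_in_sandwich (h g k : G -> Cplx R) :
  Cc (@units G) h -> Cc setT g -> Cc (@units G) k ->
  Cc setT (fun x => h (grng x) * g x * k (gsrc x)) /\
  rc_in A (fun x => h (grng x) * g x * k (gsrc x)) =
  cs_mul (cs_mul (rc_in A h) (rc_in A g)) (rc_in A k).
Proof.
move=> ch cg ck.
have [[ch' _ _] [ck' _ _]] := (ch, ck).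
have supp (l : G -> Cplx R) : Cc (@units G) l -> forall y, l y != 0 -> units y.
  by move=> [_ _ sl] y ly; apply: sl; exact: subset_closure.
have chr : continuous (h \o @grng G).
  by move=> x; apply: continuous_comp; [exact: grng_continuous|exact: ch'].
have cks : continuous (k \o @gsrc G).
  by move=> x; apply: continuous_comp; [exact: gsrc_continuous|exact: ck'].
have hgE : convolution h g = (fun x => h (grng x) * g x).
  by apply/funext => x; rewrite convolution_unitl //; exact: supp.
have chg : Cc setT (fun x => h (grng x) * g x).
  rewrite (_ : (fun x => _) = (fun x => g x * (h \o @grng G) x)).
    by apply: Cc_mul => // y _; exact: chr.
  by apply/funext => x; rewrite mulrC.
split.
  by apply: (@Cc_mul _ _ _ _ (k \o @gsrc G) chg) => y _; exact: cks.
have T l : Cc (@units G) l -> Cc setT l by exact: Cc_subset.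
rewrite -rc_in_mul //; last exact: T.
rewrite hgE -rc_in_mul //; last exact: T.
by congr rc_in; apply/funext => x; rewrite convolution_unitr //; exact: supp.
Qed.

(** The map is [a |-> sum_q h_q a k_q] for the multipliers attached to [phi] and
    to the support of [g]. It is tailored to [g], but its norm is controlled by
    [phi] alone. The bound holds on [C_c(G)] by the row-column inequality and
    passes to the whole algebra by density. *)
Lemma exists_truncation (pG : principal G) (U : set G) (phi g : G -> Cplx R)
    (B : R) :
  open U -> set_inj U (@gsrc G) -> set_inj U (@grng G) -> Cc U phi ->
  0 <= B -> (forall x, modulus (phi x) <= B) -> Cc setT g ->
  exists Phi : A -> A,
  [/\ forall a b, Phi (a - b) = Phi a - Phi b,
      forall a, rnorm (Phi a) <= B * rnorm a,
      forall M a, diagonal_bimodule M -> M a -> M (Phi a) &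
      Phi (rc_in A g) = rc_in A (fun x => phi x * g x)].
Proof.
move=> oU isU irU cphi B0 phiB cg; have [_ kg _] := cg.
have [r [h [k [hkr hB k1 hkE]]]] :=
  exists_multipliers pG oU isU irU cphi phiB kg.
pose Phi a := \sum_(q <- r) cs_mul (cs_mul (rc_in A (h q)) a) (rc_in A (k q)).
have PhiE g' : Cc setT g' -> Phi (rc_in A g') =
    rc_in A (fun x => \sum_(q <- r) h q (grng x) * g' x * k q (gsrc x)).
  move=> cg'; rewrite rc_in_sum /Phi.
    rewrite big_seq [RHS]big_seq; apply: eq_bigr => q /hkr[ch ck].
    by have [_ ->] := rc_in_sandwich ch cg' ck.
  by move=> q /hkr[ch ck]; have [] := rc_in_sandwich ch cg' ck.
have PhiB a b : Phi (a - b) = Phi a - Phi b.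
  rewrite /Phi -sumrB; apply: eq_bigr => q _.
  have mulN c d : cs_mul c (- d) = - cs_mul c d :> A.
    by rewrite -[- d]scaleN1r cs_mulZr scaleN1r.
  have mulNl c d : cs_mul (- c) d = - cs_mul c d :> A.
    by rewrite -[- c]scaleN1r cs_mulZl scaleN1r.
  by rewrite cs_mulDr cs_mulDl mulN mulNl.
have Phi_in g' : Cc setT g' -> rnorm (Phi (rc_in A g')) <= B * rnorm (rc_in A g').
  move=> cg'; rewrite PhiE // -lee_fin rnorm_in; last first.
    apply: Cc_sum => q /hkr[ch ck]; by have [] := rc_in_sandwich ch cg' ck.
  apply: red_norm_row_column => //; first exact: rnorm_ge0.
  by rewrite rnorm_in.
exists Phi; split => //.
(* A crude constant [D], which depends on the partition, gives continuity; it
   only multiplies the error of approximation and so disappears. *)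
- move=> a; pose D := \sum_(q <- r) rnorm (rc_in A (h q)) * rnorm (rc_in A (k q)).
  have D0 : 0 <= D by apply: sumr_ge0 => q _; rewrite mulr_ge0 ?rnorm_ge0.
  have PhiD c : rnorm (Phi c) <= D * rnorm c.
    apply: (le_trans (rnorm_sum _ _)); rewrite mulr_suml; apply: ler_sum => q _.
    apply: (le_trans (rnorm_mul _ _)); rewrite mulrAC.
    by apply: ler_wpM2r; [exact: rnorm_ge0|exact: rnorm_mul].
  apply/ler_addgt0Pr => e e0.
  have DB0 : 0 < D + B + 1 by rewrite ltr_pwDr ?addr_ge0.
  have d0 : 0 < e / (D + B + 1) by exact: divr_gt0.
  have [g' cg' ag'] := Cc_dense a d0.
  move: ag'; set d := e / _ => ag'.
  have eE : e = (D + B + 1) * d by rewrite mulrC divfK ?gt_eqF.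
  have h1 : rnorm (Phi a) <= D * rnorm (a - rc_in A g') + B * rnorm (rc_in A g').
    have -> : Phi a = Phi (a - rc_in A g') + Phi (rc_in A g').
      by rewrite PhiB subrK.
    by apply: (le_trans (rnormD _ _)); apply: lerD; [exact: PhiD|exact: Phi_in].
  have h2 : rnorm (rc_in A g') <= rnorm (a - rc_in A g') + rnorm a.
    by rewrite rnormB -{1}[rc_in A g'](subrK a); exact: rnormD.
  have h3 : D * rnorm (a - rc_in A g') <= D * d.
    by apply: ler_wpM2l => //; exact: ltW.
  have h4 : B * rnorm (rc_in A g') <= B * (d + rnorm a).
    by apply: ler_wpM2l => //; apply: (le_trans h2); rewrite lerD2r ltW.
  apply: (le_trans h1); apply: (le_trans (lerD h3 h4)); rewrite -subr_ge0 {1}eE.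
  rewrite (_ : _ - _ = d); first exact: ltW.
  by ring.
- move=> M a [_ M0 Mlin Mmul] Ma; rewrite /Phi big_seq.
  apply: big_ind => // [b c Mb Mc|q /hkr[ch ck]].
    by rewrite -[b]scale1r; exact: Mlin.
  have diag l : Cc (@units G) l -> Defs.diagonal (rc_in A l).
    by move=> cl; apply: subset_closure; exists l.
  have [_ Mha] := Mmul _ _ Ma (diag _ ch).
  by have [] := Mmul _ _ Mha (diag _ ck).
- rewrite PhiE //; congr rc_in; apply/funext => x.
  have [gx|gx] := eqVneq (g x) 0.
    by rewrite gx mulr0 big1 // => q _; rewrite mulr0 mul0r.
  rewrite -hkE; last exact: subset_closure.
  by rewrite mulr_suml; apply: eq_bigr => q _; rewrite mulrAC.
Qed.

End ReducedAlgebra.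

(** * Diagonal bimodules contain the functions supported in their spectrum *)

Section SpectralSynthesis.
Variables (R : realType) (G : etale_groupoid) (A : reduced_cstar R G).
Variables (j : A -> G -> Cplx R) (M : set A).
Hypotheses (hj : is_coefficient_map j) (pG : principal G)
  (hM : diagonal_bimodule M).

(** Write [f = psi * b * j a] with [psi] in [C_c(U)], and put [phi = psi * b]. For
    [g] in [C_c(G)] close to [a], the truncation [Phi] attached to [phi] and [g]
    satisfies [f - Phi a = (psi * (j a - g)) * b + Phi (g - a)]. The second term is
    small as [Phi] is bounded in terms of [phi]. The first is a second truncation
    [Psi] applied to the fixed element [b], whose multiplier
    [psi * (j a - g)] is uniformly small because [j] is norm-decreasing. *)
Lemma bimodule_contains_local (a : A) (U : set G) (b f : G -> Cplx R) :
  M a -> open U -> set_inj U (@gsrc G) -> set_inj U (@grng G) -> Cc U b ->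
  Cc [set x | b x != 0 /\ j a x != 0] f -> M (rc_in A f).
Proof.
move=> Ma oU isU irU cb cf; have [j_C0 j_lin j_norm _ j_in] := hj.
have [clM _ _ _] := hM; have [cb' _ sb] := cb; have [_ _ sf] := cf.
have cja c : continuous (j c) by have [] := j_C0 c.
have bU x : b x != 0 -> U x by move=> bx; apply: sb; exact: subset_closure.
pose psi x := f x * (j a x * b x)^-1.
have cpsi : Cc [set x | b x != 0 /\ j a x != 0] psi.
  apply: Cc_mul => // x /sf [bx ax]; apply: cvgV; first by rewrite mulf_neq0.
  by apply: cvgM; [exact: cja|exact: cb'].
have cpsiU : Cc U psi by apply: Cc_subset cpsi => x [/bU].
pose phi x := psi x * b x.
have cphi : Cc U phi by apply: Cc_mul => // x _; exact: cb'.
have [B1 B10 psiB] := Cc_bounded cpsi; have [B2 B20 phiB] := Cc_bounded cphi.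
have T P (l : G -> Cplx R) : Cc P l -> Cc setT l by exact: Cc_subset.
rewrite ((closure_id _).1 clM); apply/closure_rnorm => e e0.
pose D := B1 * rnorm (rc_in A b) + B2 + 1.
have D0 : 0 < D by rewrite ltr_pwDr // addr_ge0 // mulr_ge0 ?rnorm_ge0.
have [g cg ag] := Cc_dense a (divr_gt0 e0 D0).
have [Phi [PhiB Phi_le PhiM Phig]] :=
  exists_truncation A pG oU isU irU cphi B20 phiB cg.
exists (Phi a); first exact: PhiM.
pose F x := psi x * (j a x - g x).
have cF : Cc U F.
  apply: Cc_mul => // x _; apply: cvgB; first exact: cja.
  by case: cg => + _ _; apply.
have FB x : modulus (F x) <= B1 * (e / D).
  rewrite modulusM; apply: ler_pM => //; try exact: modulus_ge0.
  apply: le_trans (ltW ag); rewrite -lecR -modulusE -rnormE.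
  have -> : j a x - g x = j (a - rc_in A g) x; last exact: j_norm.
  have := j_lin (-1) (rc_in A g) a x.
  by rewrite scaleN1r addrC j_in // => ->; rewrite mulN1r addrC.
have Be0 : 0 <= B1 * (e / D) by rewrite mulr_ge0 // ltW // divr_gt0.
have [Psi [_ Psi_le _ Psib]] :=
  exists_truncation A pG oU isU irU cF Be0 FB (T _ _ cb).
have fE : rc_in A f - rc_in A (fun x => phi x * g x) = rc_in A (fun x => F x * b x).
  rewrite -rc_inB; last 2 first.
  - exact: T cf.
  - by apply: Cc_mul; [exact: T cphi|move=> x _; case: cg => + _ _; apply].
  congr rc_in; apply/funext => x; rewrite /F /phi /psi.
  have [->|fx] := eqVneq (f x) 0; first by rewrite !mul0r subrr.
  have [bx ax] : b x != 0 /\ j a x != 0 by apply: sf; exact: subset_closure.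
  by field; apply/andP.
have -> : rc_in A f - Phi a = Psi (rc_in A b) + Phi (rc_in A g - a).
  by rewrite Psib PhiB Phig -fE addrA subrK.
apply: (le_lt_trans (rnormD _ _)).
have h1 := Psi_le (rc_in A b); have h2 := Phi_le (rc_in A g - a).
have h3 : B2 * rnorm (rc_in A g - a) <= B2 * (e / D).
  by apply: ler_wpM2l => //; rewrite rnormB ltW.
have eE : e = D * (e / D) by rewrite mulrC divfK ?gt_eqF.
apply: (le_lt_trans (lerD h1 (le_trans h2 h3))).
have d0 : 0 < e / D by exact: divr_gt0.
rewrite [ltRHS]eE; move: (e / D) d0 => d d0; rewrite -subr_gt0.
by rewrite (_ : _ - _ = d) // /D; ring.
Qed.

(** The factorization [f = sum_q q^2 f] over a fine square partition on the
    support of [f] reduces to functions that live in an open bisection on which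
    a single element of [M] does not vanish. *)
Lemma bimodule_contains_Cc_spectrum (f : G -> Cplx R) :
  Cc (spectrum j M) f -> M (rc_in A f).
Proof.
move=> cf; have [cf' kf sf] := cf; have [_ M0 Mlin _] := hM.
set K := closure _ in kf sf.
have /choice[V hV] : forall x, exists V : set G, K x -> [/\ open V, V x &
    forall l, Cc V l -> M (rc_in A l)].
  move=> x; have [Kx|nKx] := pselect (K x); last by exists set0.
  have [a Ma ax] := sf x Kx; have [U [oU Ux isU irU]] := exists_bisection x.
  have [b [cb bx kb sb]] := exists_bump R (@g_locally_compact G)
    (@g_hausdorff G) oU Ux.
  exists [set y | (b y)%:C%C != 0 :> Cplx R /\ j a y != 0] => _; split.
  - have nz (l : G -> Cplx R) : continuous l -> open (l @^-1` [set z | z != 0]).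
      move=> cl; apply: open_comp => [y _|]; first exact: cl.
      have -> : [set z : Cplx R | z != 0] = ~` [set 0].
        by apply/seteqP; split => z /= /eqP.
      apply: closed_openC; apply: compact_closed; last exact: compact_set1.
      exact: norm_hausdorff.
    apply: openI; [apply: (nz (fun y => (b y)%:C%C))|apply: (nz (j a))].
      by move=> y; exact/continuous_real_complex/cb.
    by have [/(_ a)[+ _] _ _ _ _] := hj; apply.
  - by split => //; rewrite bx oner_eq0.
  - by move=> l; apply: bimodule_contains_local Ma oU isU irU _; exact: Cc_real.
have [r [rP _ r1]] := square_partition R (@g_locally_compact G) (@g_hausdorff G)
  kf (fun x Kx => let: And3 o xV _ := hV x Kx in conj o xV).
pose F (q : G -> R) x := (q x)%:C%C * ((q x)%:C%C * f x).
have fE : f = (fun x => \sum_(q <- r) F q x).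
  apply/funext => x.
  have [fx|fx] := eqVneq (f x) 0.
    by rewrite fx big1 // => q _; rewrite /F fx !mulr0.
  under eq_bigr do rewrite /F mulrA -rmorphM -expr2.
  by rewrite -mulr_suml -rmorph_sum r1 ?rmorph1 ?mul1r //; exact: subset_closure.
have FM q : q \in r -> Cc setT (F q) /\ M (rc_in A (F q)).
  move=> /rP[cq [kq [x Kx sq]]]; have [_ _ hVx] := hV x Kx.
  have cqC := continuous_real_complex (cq _).
  have cF : Cc (V x) (F q).
    apply: Cc_mul; first exact: Cc_real.
    by move=> y _; apply: cvgM; [exact: cqC|exact: cf'].
  by split; [exact: Cc_subset cF|exact: hVx].
rewrite fE rc_in_sum => [|q /FM[] //]; rewrite big_seq.
apply: big_ind => // [b c Mb Mc|q /FM[] //].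
by rewrite -[b]scale1r; exact: Mlin.
Qed.

End SpectralSynthesis.

Theorem corollary3p19 (R : realType) (G : etale_groupoid)
    (A : reduced_cstar R G) (j : A -> G -> Cplx R)
    (hj : is_coefficient_map j)
    (hG : principal G)
    (hF : fourier_approximation j)
    (M : set A) (hM : diagonal_bimodule M) :
  spectral j M.
Proof.
apply/seteqP; split=> [a Ma x|a ha].
  move=> nx; apply/eqP; apply: contrapT => /negP ax; apply: nx; by exists a.
have [clM _ _ _] := hM; rewrite ((closure_id _).1 clM).
apply: closureS (hF a) => _ [f cf <-].
apply: (bimodule_contains_Cc_spectrum hj hG hM); apply: Cc_subset cf => x ax.
by apply: contrapT => /ha e; move: ax; rewrite /supp' /= e eqxx.
Qed.
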